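(* Let $b$ be a canonically compactifiable graph over $(X,m)$ such that $m(X)<\infty$, and let $0\neq h\in\ell^2(X,m)$. Then there is a $u\in D(L)$ with $$Lu=he^u$$ if and only if $\overline h<0$ and $h$ changes sign (i.e. $h$ takes both a strictly positive and a strictly negative value).
   Context: $X$ is a countable (finite or countably infinite) set with the discrete topology. A graph on $X$ is a symmetric function $b:X\times X\to[0,\infty)$ vanishing on the diagonal with $\sum_{y\in X}b(x,y)<\infty$ for every $x\in X$. It is connected if for all $x,y\in X$ there are $x_1,\dots,x_n\in X$ with $b(x,x_1)>0,\,b(x_1,x_2)>0,\dots,b(x_n,y)>0$. The measure $m$ is given by a function $m:X\to(0,\infty)$ via $m(A)=\sum_{x\in A}m(x)$, with $m(X)<\infty$. $\ell^p(X,m)$, $1\le p<\infty$, is the space of real-valued functions $f$ on $X$ with $\|f\|_p=(\sum_{x}|f(x)|^pm(x))^{1/p}<\infty$, and $\ell^\infty(X)$ is the space of bounded real-valued functions. $\langle f,g\rangle=\sum_x f(x)g(x)m(x)$. The mean of $f$ is $\overline f=\frac{1}{m(X)}\langle f,1\rangle$. For $u:X\to\mathbb R$ let $\widetilde Q(u)=\frac12\sum_{x,y\in X}b(x,y)(u(x)-u(y))^2\in[0,\infty]$ and $\widetilde D=\{u:\widetilde Q(u)<\infty\}$. $Q$ is the restriction of $\widetilde Q$ to $D(Q)=\widetilde D\cap\ell^2(X,m)$; by polarization, $Q(u,v)=\frac12\sum_{x,y}b(x,y)(u(x)-u(y))(v(x)-v(y))$. The Neumann Laplacian $L$ is the self-adjoint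 operator on $\ell^2(X,m)$ with $D(L)=\{u\in D(Q):\text{there is }f\in\ell^2(X,m)\text{ with }Q(u,v)=\langle f,v\rangle\text{ for all }v\in D(Q)\}$ and $Lu=f$. A connected graph $b$ over $(X,m)$ is called canonically compactifiable if $D(Q)\subseteq\ell^\infty(X)$. *)

(* Defs.v *)
From HB Require Import structures.
From mathcomp Require Import all_boot all_order all_algebra.
From mathcomp Require Import all_classical all_reals all_analysis.

Set Implicit Arguments.
Unset Strict Implicit.
Unset Printing Implicit Defensive.

Import Order.TTheory GRing.Theory Num.Theory.

Local Open Scope classical_set_scope.
Local Open Scope ring_scope.

(* Sum of an absolutely summable real family. The value is meaningful only
   when [summable [set: I] (EFin \o f)] holds, which is the case wherever
   [tsum] is used below. *)
Definition tsum (R : realType) (I : choiceType) (f : I -> R) : R :=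
  fine (\esum_(i in [set: I]) ((EFin \o f)^\+ i)%E)
  - fine (\esum_(i in [set: I]) ((EFin \o f)^\- i)%E).

Record weighted_graph (R : realType) (X : countType) := WeightedGraph {
  weight :> X -> X -> R;
  weight_ge0 : forall x y, 0 <= weight x y;
  weight_sym : forall x y, weight x y = weight y x;
  weight_diag : forall x, weight x x = 0;
  weight_deg : forall x, (\esum_(y in [set: X]) (weight x y)%:E < +oo)%E
}.

Section Graph.
Variables (R : realType) (X : countType).
Variables (b : weighted_graph R X) (m : X -> R).
Implicit Types (u v f g h : X -> R) (A : set X).

(* A chain from x to x must leave x and return, since b vanishes on the
   diagonal. *)
Definition connected_graph : Prop :=
  forall x y, exists s : seq X, path (fun z w => 0 < b z w) x (rcons s y).

Definition vol A : \bar R := (\esum_(x in A) (m x)%:E)%E.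

Definition ell2 : set (X -> R) :=
  [set f | (\esum_(x in [set: X]) (`|f x| ^+ 2 * m x)%:E < +oo)%E].

Definition ellinfty : set (X -> R) := [set f | exists M, forall x, `|f x| <= M].

Definition inner f g : R := tsum (fun x => f x * g x * m x).

Definition mean f : R := (fine (vol [set: X]))^-1 * inner f (cst 1).

Definition energy u : \bar R :=
  ((2^-1)%:E *
   \esum_(p in [set: X * X]) (b p.1 p.2 * (u p.1 - u p.2) ^+ 2)%:E)%E.

Definition finite_energy : set (X -> R) := [set u | (energy u < +oo)%E].

Definition domQ : set (X -> R) := finite_energy `&` ell2.

Definition Qform u v : R :=
  2^-1 * tsum (fun p : X * X => b p.1 p.2 * (u p.1 - u p.2) * (v p.1 - v p.2)).

Definition represents_Q u f : Prop :=
  ell2 f /\ forall v, domQ v -> Qform u v = inner f v.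

Definition domL : set (X -> R) :=
  [set u | domQ u /\ exists f, represents_Q u f].

(* For u in domL the representing f is unique, because domQ contains the
   indicator functions of points; outside domL the value is a dummy. *)
Definition laplacian u : X -> R := xget (cst 0) [set f | represents_Q u f].

Definition canonically_compactifiable : Prop :=
  connected_graph /\ domQ `<=` ellinfty.

Definition changes_sign h : Prop := (exists x, 0 < h x) /\ (exists x, h x < 0).

End Graph.

(* Main.v *)
Require Import Defs.
From HB Require Import structures.
From mathcomp Require Import all_boot all_order all_algebra.
From mathcomp Require Import all_classical all_reals all_analysis.
From mathcomp Require Import finmap ring lra.

Import Order.TTheory GRing.Theory Num.Theory.
Import numFieldNormedType.Exports.

Local Open Scope classical_set_scope.
Local Open Scope ring_scope.

(** Write E(u, v) for [dirichlet b u v], which is twice the form Q, and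
    l_u(v) = <h e^u, v> for [exp_pairing m h u v]. A solution is a u in D(Q)
    with E(u, v) = 2 l_u(v) for all v in D(Q).

    Necessity ([solution_necessary]). Every u in D(Q) is bounded, so constants
    and e^{-u} are admissible test functions. The constant 1 gives
    <h e^u, 1> = 0, hence h takes both signs. The function e^{-u} gives
    E(u, e^{-u}) = 2 <h, 1>; since the exponential is increasing the left side
    is at most 0, and it vanishes only for constant u, for which the equation
    would force h = 0.

    Sufficiency ([solution_exists]). Minimise E(u, u) over the u in D(Q) with
    l_u(1) = <h, e^u> >= 0; the set is not empty because h is positive
    somewhere. Adding a constant to u keeps the sign of l_u(1) and the energy,
    so a minimising sequence can be pinned to 0 at a vertex. The key estimate
    [uniform_bound] says that on a canonically compactifiable graph
    |u(x) - u(o)|^2 <= C E(u, u) with C independent of x and u, so the sequence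
    is uniformly bounded. It converges pointwise along an ultrafilter, and
    Fatou's lemma ([tsum_fatou]) shows both that the energy does not increase
    in the limit and that the constraint survives ([minimizer_exists]).

    Using an inequality as constraint makes the Euler-Lagrange equation
    elementary. If l_u(v) > 0 then u + t v is feasible for small t > 0, so
    E(u, v) >= 0 ([first_variation]). A linear form that is nonnegative on an
    open half-space is a nonnegative multiple of the form defining it, so
    E(u, v) = a l_u(v) for all v, with a >= 0 ([euler_lagrange]). If a were 0
    then u would be a constant c and l_u(1) = e^c <h, 1> < 0, against
    feasibility; this is where the mean of h enters. With a > 0, adding
    ln (a / 2) to u turns the multiplier into the 2 required above. *)

(** * Absolutely summable real families *)

Definition abs_summable {R : realType} {I : choiceType} (f : I -> R) : Prop :=
  summable [set: I] (EFin \o f).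

Section RealSums.
Context {R : realType} {I : choiceType}.
Implicit Types f g a : I -> R.

(** Passes from extended-real sums to finite real sums, so that the estimates
    below can be carried out in R. *)
Lemma esum_leP a c : (forall i, 0 <= a i) ->
  (\esum_(i in [set: I]) (a i)%:E <= c%:E)%E <->
  (forall s : seq I, uniq s -> \sum_(i <- s) a i <= c).
Proof.
move=> a0; split.
- move=> le s us; rewrite -lee_fin; apply: le_trans le.
  apply: esum_ge; exists [set` s]; first by split.
  by rewrite -fsbig_seq //= sumEFin.
- move=> H; apply: ge_ereal_sup => _ [A [finA _] <-].
  rewrite fsbig_finite //= sumEFin lee_fin; apply: H.
  exact: finmap.fset_uniq.
Qed.

Lemma abs_summable_tsum f : (forall i, 0 <= f i) -> abs_summable f ->
  (\esum_(i in [set: I]) (f i)%:E)%E = (tsum f)%:E.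
Proof.
move=> f0 sf.
have E : (\esum_(i in [set: I]) ((EFin \o f) i))%E
   = (\esum_(i in [set: I]) `|(EFin \o f) i|)%E.
  by apply: eq_esum => i _ /=; rewrite ger0_norm.
have fin : (\esum_(i in [set: I]) ((EFin \o f) i))%E \is a fin_num.
  by rewrite E -summableE.
rewrite -[LHS]fineK //; congr EFin; rewrite /tsum.
rewrite [X in _ - fine X]esum1 ?subr0; last first.
  by move=> i _; rewrite funenegE; apply/max_idPr; rewrite /= lee_fin oppr_le0.
congr fine; apply: eq_esum => i _; rewrite funeposE.
by apply/esym/max_idPl; rewrite /= lee_fin.
Qed.

Lemma ge0_esum_fin f c : (forall i, 0 <= f i) ->
  (\esum_(i in [set: I]) (f i)%:E <= c%:E)%E <->
  abs_summable f /\ tsum f <= c.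
Proof.
move=> f0; split => [le|[sf le]]; last by rewrite abs_summable_tsum // lee_fin.
have sf : abs_summable f.
  rewrite /abs_summable /summable (@eq_esum _ _ _ _ (EFin \o f)).
    by apply: le_lt_trans le _; rewrite ltry.
  by move=> i _ /=; rewrite ger0_norm.
by split => //; rewrite -lee_fin -abs_summable_tsum.
Qed.

Lemma ge0_abs_summable f : (forall i, 0 <= f i) ->
  (\esum_(i in [set: I]) (f i)%:E < +oo)%E <-> abs_summable f.
Proof.
move=> f0; rewrite /abs_summable /summable.
rewrite (@eq_esum _ _ _ (fun x => `|(EFin \o f) x|)%E (EFin \o f)) //.
by move=> i _ /=; rewrite ger0_norm.
Qed.

Lemma le_abs_summable f g : (forall i, `|f i| <= g i) -> abs_summable g ->
  abs_summable f.
Proof.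
move=> fg; apply: le_lt_trans; apply: le_esum => i _ /=.
by rewrite lee_fin (le_trans (fg i)) // ler_norm.
Qed.

Lemma abs_summable_norm f : abs_summable f -> abs_summable (fun i => `|f i|).
Proof.
apply: le_lt_trans; apply: le_esum => i _ /=.
by rewrite normr_id.
Qed.

Lemma abs_summableD f g : abs_summable f -> abs_summable g ->
  abs_summable (fun i => f i + g i).
Proof. by move=> sf sg; exact: summableD sf sg. Qed.

Lemma abs_summableZ c f : abs_summable f -> abs_summable (fun i => c * f i).
Proof.
move=> /abs_summable_norm sf.
have af i : 0 <= `|f i| by [].
have /(ge0_esum_fin _ _ af).2/(esum_leP _ _ af) H :
  abs_summable (fun i => `|f i|) /\
  tsum (fun i => `|f i|) <= tsum (fun i => `|f i|) by [].
apply: (@le_abs_summable _ (fun i => `|c| * `|f i|)) => [i|]; first by rewrite normrM.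
have caf i : 0 <= `|c| * `|f i| by rewrite mulr_ge0.
suff /(ge0_esum_fin _ _ caf).1[] :
  (\esum_(i in [set: I]) (`|c| * `|f i|)%:E <= (`|c| * tsum (fun i => `|f i|))%:E)%E by [].
by apply/esum_leP => // s us; rewrite -mulr_sumr ler_wpM2l // H.
Qed.

Lemma abs_summableN f : abs_summable f -> abs_summable (fun i => - f i).
Proof. by move=> /(abs_summableZ (-1)); under eq_fun do rewrite mulN1r. Qed.

Lemma abs_summableB f g : abs_summable f -> abs_summable g ->
  abs_summable (fun i => f i - g i).
Proof. by move=> sf /abs_summableN; exact: abs_summableD. Qed.

Lemma abs_summable0 : abs_summable (fun _ : I => 0 : R).
Proof.
by rewrite /abs_summable /summable esum1 // => i _ /=; rewrite normr0.
Qed.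

(** The base of all linearity statements: [tsum f] may be computed from any
    decomposition of f into two nonnegative summable parts. A general family is
    then handled through f = (f + |f|) - |f|. *)
Lemma tsumB_ge0 f g : (forall i, 0 <= f i) -> (forall i, 0 <= g i) ->
  abs_summable f -> abs_summable g ->
  tsum (fun i => f i - g i) = tsum f - tsum g.
Proof.
move=> f0 g0 sf sg; apply: EFin_inj; rewrite [RHS]EFinB.
rewrite -(abs_summable_tsum f) // -(abs_summable_tsum g) //.
rewrite -(@esumB R I setT (EFin \o f) (EFin \o g) sf sg);
  [|by move=> i _; rewrite /= lee_fin..].
have sfg : abs_summable (fun i => f i - g i) by apply: abs_summableB.
have fin (g' : I -> \bar R) : (forall i, 0 <= g' i)%E -> summable setT g' ->
    (\esum_(i in [set: I]) g' i)%E \is a fin_num.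
  move=> g'0; rewrite summableE.
  by under eq_esum do rewrite gee0_abs //.
rewrite [LHS]EFinB !fineK //; apply: fin => //.
- exact: summable_funeneg sfg.
- exact: summable_funepos sfg.
Qed.

Lemma tsumD_ge0 f g : (forall i, 0 <= f i) -> (forall i, 0 <= g i) ->
  abs_summable f -> abs_summable g ->
  tsum (fun i => f i + g i) = tsum f + tsum g.
Proof.
move=> f0 g0 sf sg.
have fg0 i : 0 <= f i + g i by rewrite addr_ge0.
have sfg := abs_summableD _ _ sf sg.
have := tsumB_ge0 _ _ fg0 g0 sfg sg.
under eq_fun do rewrite addrK.
by move=> ->; rewrite subrK.
Qed.

Let shift0 f i : 0 <= f i + `|f i|.
Proof. by have := ler_norm (- f i); rewrite normrN; lra. Qed.

Let sshift f : abs_summable f -> abs_summable (fun i => f i + `|f i|).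
Proof. by move=> sf; apply: abs_summableD => //; exact: abs_summable_norm. Qed.

Let tsumE f : abs_summable f ->
  tsum f = tsum (fun i => f i + `|f i|) - tsum (fun i => `|f i|).
Proof.
move=> sf; rewrite -tsumB_ge0 //.
- by under [in RHS]eq_fun do rewrite addrK.
- exact: sshift.
- exact: abs_summable_norm.
Qed.

Lemma tsumD f g : abs_summable f -> abs_summable g ->
  tsum (fun i => f i + g i) = tsum f + tsum g.
Proof.
move=> sf sg; rewrite (tsumE _ sf) (tsumE _ sg).
have [nf ng] := (abs_summable_norm _ sf, abs_summable_norm _ sg).
rewrite addrACA -opprD -!tsumD_ge0 //; try exact: sshift.
rewrite -tsumB_ge0 //.
- by congr tsum; apply/funext => i; ring.
- by move=> i; rewrite addr_ge0.
- by apply: abs_summableD; apply: sshift.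
- exact: abs_summableD.
Qed.

Lemma tsum0 : tsum (fun _ : I => 0 : R) = 0.
Proof.
by apply: EFin_inj; rewrite -abs_summable_tsum ?esum1 //; exact: abs_summable0.
Qed.

Lemma tsumN f : abs_summable f -> tsum (fun i => - f i) = - tsum f.
Proof.
move=> sf; apply/eqP; rewrite -addr_eq0 -tsumD //; last exact: abs_summableN.
by under eq_fun do rewrite addNr; rewrite tsum0.
Qed.

Lemma tsumB f g : abs_summable f -> abs_summable g ->
  tsum (fun i => f i - g i) = tsum f - tsum g.
Proof.
by move=> sf sg; rewrite -tsumN // -tsumD //; exact: abs_summableN.
Qed.

Lemma tsum_ge0 f : (forall i, 0 <= f i) -> abs_summable f -> 0 <= tsum f.
Proof.
by move=> f0 sf; rewrite -lee_fin -abs_summable_tsum //; apply: esum_ge0 => i _; rewrite lee_fin.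
Qed.

Lemma ler_tsum f g : abs_summable f -> abs_summable g ->
  (forall i, f i <= g i) -> tsum f <= tsum g.
Proof.
move=> sf sg fg; rewrite -subr_ge0 -tsumB //; apply: tsum_ge0.
  by move=> i; rewrite subr_ge0.
exact: abs_summableB.
Qed.

Lemma sum_le_tsum f (s : seq I) : (forall i, 0 <= f i) -> abs_summable f ->
  uniq s -> \sum_(i <- s) f i <= tsum f.
Proof.
move=> f0 sf; apply: (esum_leP _ _ f0).1.
by apply/ge0_esum_fin.
Qed.

Lemma term_le_tsum f i : (forall i, 0 <= f i) -> abs_summable f -> f i <= tsum f.
Proof.
by move=> f0 sf; have := sum_le_tsum _ [:: i] f0 sf; rewrite big_seq1; apply.
Qed.

Lemma tsum_le f c : (forall i, 0 <= f i) ->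
  (forall s, uniq s -> \sum_(i <- s) f i <= c) -> abs_summable f /\ tsum f <= c.
Proof. by move=> f0 H; apply/ge0_esum_fin => //; apply/esum_leP. Qed.

Lemma tsum_eq0 f i : (forall i, 0 <= f i) -> abs_summable f -> tsum f <= 0 ->
  f i = 0.
Proof.
move=> f0 sf le; apply/eqP; rewrite eq_le f0 andbT.
by apply: le_trans le; apply: term_le_tsum.
Qed.

Let tsumZ_ge0 c f : 0 <= c -> (forall i, 0 <= f i) -> abs_summable f ->
  tsum (fun i => c * f i) = c * tsum f.
Proof.
have le d g : 0 <= d -> (forall i, 0 <= g i) -> abs_summable g ->
    tsum (fun i => d * g i) <= d * tsum g.
  move=> d0 g0 sg; apply: (tsum_le _ _ _ _).2 => [i|s us]; first by rewrite mulr_ge0.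
  by rewrite -mulr_sumr ler_wpM2l // sum_le_tsum.
rewrite le_eqVlt => /predU1P[<-|c0] f0 sf.
  by under eq_fun do rewrite mul0r; rewrite tsum0 mul0r.
apply/eqP; rewrite eq_le le //=; last exact: ltW.
rewrite -ler_pdivlMl //.
have cf0 i : 0 <= c * f i by rewrite mulr_ge0 // ltW.
have c'0 : 0 <= c^-1 by rewrite invr_ge0 ltW.
have := le c^-1 (fun i => c * f i) c'0 cf0 (abs_summableZ c _ sf).
by under eq_fun do rewrite mulKf ?gt_eqF //.
Qed.

Lemma tsumZ c f : abs_summable f -> tsum (fun i => c * f i) = c * tsum f.
Proof.
move=> sf.
have ge d : 0 <= d -> tsum (fun i => d * f i) = d * tsum f.
  move=> d0; rewrite [in RHS]tsumE // mulrBr -!tsumZ_ge0 //;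
    [|exact: abs_summable_norm|exact: sshift].
  rewrite -tsumB.
  - by congr tsum; apply/funext => i; ring.
  - by apply: abs_summableZ; exact: sshift.
  - by apply: abs_summableZ; exact: abs_summable_norm.
have [c0|c0] := lerP 0 c; first exact: ge.
have := ge (- c); rewrite oppr_ge0 ltW // => /(_ isT).
under eq_fun do rewrite mulNr.
by rewrite tsumN ?mulNr; [move/oppr_inj|exact: abs_summableZ].
Qed.

Lemma abs_summable_single f i0 : (forall i, i != i0 -> f i = 0) -> abs_summable f.
Proof.
move=> f0; have nf i : 0 <= `|f i| by [].
have [|s us|H _] := @tsum_le (fun i => `|f i|) `|f i0|; first by [].
  have [i0s|i0s] := boolP (i0 \in s).
    rewrite (bigD1_seq i0) //= big1 ?addr0 // => i ne.
    by rewrite f0 // normr0.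
  rewrite big_seq big1 // => i si.
  by rewrite f0 ?normr0 //; apply: contraNneq i0s => <-.
exact: le_abs_summable H.
Qed.

Lemma tsum_single f i0 : (forall i, i != i0 -> f i = 0) -> tsum f = f i0.
Proof.
have ge g : (forall i, i != i0 -> g i = 0) -> (forall i, 0 <= g i) -> tsum g = g i0.
  move=> h0 g0; have sg := abs_summable_single _ _ h0.
  apply/eqP; rewrite eq_le term_le_tsum // andbT.
  apply: (tsum_le _ _ _ _).2 => // s us.
  have [i0s|i0s] := boolP (i0 \in s).
    by rewrite (bigD1_seq i0) //= big1 ?addr0 // => i ne; rewrite h0.
  rewrite big_seq big1 // => i si.
  by rewrite h0 //; apply: contraNneq i0s => <-.
move=> f0; rewrite tsumE; last exact: abs_summable_single f0.
rewrite !ge ?addrK //.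
  by move=> i /f0 ->; rewrite normr0.
by move=> i /f0 ->; rewrite normr0 addr0.
Qed.

Lemma ler_sum_subset f (s t : seq I) : (forall i, 0 <= f i) -> uniq s -> uniq t ->
  {subset t <= s} -> \sum_(i <- t) f i <= \sum_(i <- s) f i.
Proof.
move=> f0 us ut ts.
have -> : \sum_(i <- t) f i = \sum_(i <- [seq i <- s | i \in t]) f i.
  apply: perm_big; apply: uniq_perm => //; first exact: filter_uniq.
  by move=> i; rewrite mem_filter; case: (boolP (i \in t)) => // /ts ->.
by rewrite big_filter big_mkcond ler_sum // => i _; case: ifP.
Qed.

(** Otherwise all finite sums would stay below [tsum a - e]. *)
Lemma summable_tail_small a e : (forall i, 0 <= a i) -> abs_summable a -> 0 < e ->
  exists2 s : seq I, uniq s & forall t, uniq t -> (forall i, i \in t -> i \notin s) ->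
    \sum_(i <- t) a i <= e.
Proof.
move=> a0 sa e0; apply: contrapT => H.
suff : tsum a <= tsum a - e by lra.
apply: (tsum_le _ _ a0 _).2 => s us; rewrite leNgt; apply/negP => lt.
apply: H; exists s => // t ut ts.
have /(sum_le_tsum _ _ a0 sa) : uniq (s ++ t).
  rewrite cat_uniq us ut andbT; apply/hasPn => i /ts; exact.
rewrite big_cat /=; lra.
Qed.

Lemma abs_summable_sum {J : Type} (s : seq J) (F : J -> I -> R) :
  (forall j, abs_summable (F j)) ->
  abs_summable (fun i => \sum_(j <- s) F j i) /\
  tsum (fun i => \sum_(j <- s) F j i) = \sum_(j <- s) tsum (F j).
Proof.
move=> sF; elim: s => [|j s [IHs IHt]].
  rewrite big_nil; under eq_fun do rewrite big_nil.
  by split; [exact: abs_summable0|exact: tsum0].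
rewrite big_cons; under eq_fun do rewrite big_cons.
by split; [exact: abs_summableD|rewrite tsumD // IHt].
Qed.

End RealSums.

(** One half of Tonelli's theorem: exchanging a finite sum over J
    with the sum over I bounds every finite partial sum by [tsum c]. *)
Lemma tsum_interchange_le {R : realType} {I J : choiceType} (F : I -> J -> R)
    (c : I -> R) : (forall i j, 0 <= F i j) ->
  (forall i, abs_summable (F i) /\ tsum (F i) <= c i) -> abs_summable c ->
  (forall j, abs_summable (F^~ j)) /\ abs_summable (fun j => tsum (F^~ j)).
Proof.
move=> F0 sF sc.
have Fc i j : F i j <= c i by apply: le_trans (sF i).2; apply: term_le_tsum (sF i).1.
have sFj j : abs_summable (F^~ j).
  by apply: le_abs_summable sc => i; rewrite ger0_norm.
split => //; have G0 j : 0 <= tsum (F^~ j) by exact: tsum_ge0.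
apply: (tsum_le _ (tsum c) G0 _).1 => s us.
have [sS <-] := abs_summable_sum s (fun j i => F i j) sFj.
apply: ler_tsum => // i; apply: le_trans (sF i).2.
exact: sum_le_tsum (sF i).1 us.
Qed.

Lemma abs_summable_geometric {R : realType} : abs_summable (fun n => 2^-1 ^+ n : R).
Proof.
have p0 n : 0 <= (2^-1 : R) ^+ n by rewrite exprn_ge0 // invr_ge0.
apply: (tsum_le _ 2 p0 _).1 => s us.
pose N := (\max_(i <- s) i).+1.
apply: (@le_trans _ _ (\sum_(i <- iota 0 N) 2^-1 ^+ i)).
  apply: ler_sum_subset => //; first exact: iota_uniq.
  by move=> i si; rewrite mem_iota add0n ltnS leq_bigmax_seq.
suff -> : \sum_(i <- iota 0 N) (2^-1 : R) ^+ i = 2 - 2 * 2^-1 ^+ N.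
  by have := p0 N; lra.
elim: N => [|n IH]; first by rewrite big_nil expr0; lra.
by rewrite -[in iota 0 n.+1]addn1 iotaD big_cat IH big_seq1 /= add0n exprS; lra.
Qed.

(** * The Dirichlet form *)

Lemma norm_mul_le_sum_sq {R : realType} (x y : R) : `|x * y| <= x * x + y * y.
Proof.
have := sqr_ge0 (x - y); have := sqr_ge0 (x + y).
have := sqr_ge0 x; have := sqr_ge0 y; rewrite !expr2 => *.
by rewrite ler_norml; apply/andP; split; lra.
Qed.

Section Dirichlet.
Context {R : realType} {X : countType}.
Variables (b : weighted_graph R X).
Implicit Types (u v w : X -> R).

(** The summand of [Qform]; hence [Qform b u v] is [2^-1 * dirichlet b u v]. *)
Definition edge_prod u v (p : X * X) : R :=
  b p.1 p.2 * (u p.1 - u p.2) * (v p.1 - v p.2).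

Definition dirichlet u v : R := tsum (edge_prod u v).

Lemma edge_prod_ge0 u p : 0 <= edge_prod u u p.
Proof. by rewrite /edge_prod -mulrA mulr_ge0 ?weight_ge0 // -expr2 sqr_ge0. Qed.

Lemma finite_energyP u : finite_energy b u <-> abs_summable (edge_prod u u).
Proof.
rewrite -ge0_abs_summable; last exact: edge_prod_ge0.
rewrite /finite_energy /= /energy.
under eq_esum do rewrite expr2 mulrA -/(edge_prod _ _ _).
set S := (\esum_(_ in _) _)%E.
have : (0 <= S)%E by apply: esum_ge0 => p _; rewrite lee_fin edge_prod_ge0.
case: S => [r| |] //= _.
  by split => _; rewrite ?ltry // -EFinM ltry.
by rewrite mulry gtr0_sg ?invr_gt0 // mul1e.
Qed.

Lemma edge_prod_summable u v : finite_energy b u -> finite_energy b v ->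
  abs_summable (edge_prod u v).
Proof.
move=> /finite_energyP su /finite_energyP sv.
apply: le_abs_summable (abs_summableD _ _ su sv) => p.
rewrite /edge_prod -!mulrA -mulrDr normrM (ger0_norm (weight_ge0 _ _ _)).
apply: ler_wpM2l; first exact: weight_ge0.
exact: norm_mul_le_sum_sq.
Qed.

Lemma dirichlet_ge0 u : finite_energy b u -> 0 <= dirichlet u u.
Proof.
by move=> /finite_energyP; apply: tsum_ge0 => p; exact: edge_prod_ge0.
Qed.

(** Composing u with a Lipschitz map does not destroy finite energy; this covers
    truncations, scalings and exponentials of bounded functions. *)
Lemma lipschitz_energy (c : R) u v : 0 <= c ->
  (forall x y, `|v x - v y| <= c * `|u x - u y|) -> finite_energy b u ->
  finite_energy b v /\ dirichlet v v <= c ^+ 2 * dirichlet u u.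
Proof.
move=> c0 uv /finite_energyP su.
have le p : edge_prod v v p <= c ^+ 2 * edge_prod u u p.
  rewrite /edge_prod -!(mulrA (b _ _)) (mulrCA (c ^+ 2)); apply: ler_wpM2l.
    exact: weight_ge0.
  rewrite -!expr2 -exprMn -(real_normK (num_real (v _ - _))).
  rewrite -(real_normK (num_real (c * _))).
  by rewrite lerXn2r ?nnegrE // normrM (ger0_norm c0) uv.
have scu := abs_summableZ (c ^+ 2) _ su.
have sv : abs_summable (edge_prod v v).
  by apply: le_abs_summable scu => p; rewrite ger0_norm ?edge_prod_ge0.
split; first exact/finite_energyP.
by rewrite /dirichlet -tsumZ //; apply: ler_tsum.
Qed.

Lemma finite_energyD u v : finite_energy b u -> finite_energy b v ->
  finite_energy b (fun x => u x + v x).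
Proof.
move=> fu fv; apply/finite_energyP.
have suv := edge_prod_summable _ _ fu fv.
have svu := edge_prod_summable _ _ fv fu.
move/finite_energyP: fu => su; move/finite_energyP: fv => sv.
have := abs_summableD _ _ (abs_summableD _ _ su suv) (abs_summableD _ _ svu sv).
by congr abs_summable; apply/funext => p; rewrite /edge_prod; ring.
Qed.

Lemma finite_energyZ c u : finite_energy b u -> finite_energy b (fun x => c * u x).
Proof.
move=> fu; apply: (lipschitz_energy `|c| u _ _ _ fu).1 => // x y.
by rewrite -mulrBr normrM.
Qed.

Lemma dirichletDr u v w : finite_energy b u -> finite_energy b v ->
  finite_energy b w ->
  dirichlet u (fun x => v x + w x) = dirichlet u v + dirichlet u w.
Proof.
move=> fu fv fw; rewrite /dirichlet -tsumD; try exact: edge_prod_summable.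
by congr tsum; apply/funext => p; rewrite /edge_prod; ring.
Qed.

Lemma dirichletZr c u v : finite_energy b u -> finite_energy b v ->
  dirichlet u (fun x => c * v x) = c * dirichlet u v.
Proof.
move=> fu fv; rewrite /dirichlet -tsumZ; try exact: edge_prod_summable.
by congr tsum; apply/funext => p; rewrite /edge_prod; ring.
Qed.

Lemma dirichletC u v : dirichlet u v = dirichlet v u.
Proof. by congr tsum; apply/funext => p; rewrite /edge_prod; ring. Qed.

Lemma dirichlet_eq u u' v v' : (forall x y, u x - u y = u' x - u' y) ->
  (forall x y, v x - v y = v' x - v' y) -> dirichlet u v = dirichlet u' v'.
Proof.
by move=> hu hv; congr tsum; apply/funext => p; rewrite /edge_prod hu hv.
Qed.

Lemma dirichlet_square u v t : finite_energy b u -> finite_energy b v ->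
  dirichlet (fun x => u x + t * v x) (fun x => u x + t * v x) =
  dirichlet u u + 2 * t * dirichlet u v + t ^+ 2 * dirichlet v v.
Proof.
move=> fu fv; have fw := finite_energyZ t _ fv.
rewrite dirichletDr //; last exact: finite_energyD.
rewrite dirichletZr //; last exact: finite_energyD.
rewrite [dirichlet _ u]dirichletC [dirichlet _ v]dirichletC !dirichletDr // !dirichletZr //.
rewrite [dirichlet v u]dirichletC; ring.
Qed.

(** Only edges at [x0] contribute, and their total weight is twice the finite
    degree of [x0]; the two copies come from the two orientations of an edge. *)
Lemma finite_energy_indic x0 : finite_energy b (fun x => (x == x0)%:R).
Proof.
apply/finite_energyP.
have deg0 : abs_summable (b x0).
  exact: (ge0_abs_summable _ (weight_ge0 b x0)).1 (weight_deg b x0).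
pose D1 (p : X * X) : R := if p.1 == x0 then b x0 p.2 else 0.
pose D2 (p : X * X) : R := if p.2 == x0 then b x0 p.1 else 0.
have D1_ge0 p : 0 <= D1 p by rewrite /D1; case: ifP => // _; exact: weight_ge0.
have D2_ge0 p : 0 <= D2 p by rewrite /D2; case: ifP => // _; exact: weight_ge0.
have sD1 : abs_summable D1.
  apply: (tsum_le _ (tsum (b x0)) D1_ge0 _).1 => s us.
  rewrite /D1 -big_mkcond /= -big_filter -(big_map snd xpredT (b x0)).
  apply: sum_le_tsum => //; first exact: weight_ge0.
  rewrite map_inj_in_uniq ?filter_uniq // => -[x y] [x' y'].
  by rewrite !mem_filter /= => /andP[/eqP-> _] /andP[/eqP-> _] ->.
have sD2 : abs_summable D2.
  apply: (tsum_le _ (tsum (b x0)) D2_ge0 _).1 => s us.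
  rewrite /D2 -big_mkcond /= -big_filter -(big_map fst xpredT (b x0)).
  apply: sum_le_tsum => //; first exact: weight_ge0.
  rewrite map_inj_in_uniq ?filter_uniq // => -[x y] [x' y'].
  by rewrite !mem_filter /= => /andP[/eqP-> _] /andP[/eqP-> _] ->.
apply: le_abs_summable (abs_summableD _ _ sD1 sD2) => -[x y].
rewrite ger0_norm ?edge_prod_ge0 // /edge_prod /D1 /D2 /=.
have := weight_ge0 b x y; have := weight_sym b x y.
have := weight_ge0 b x0 y; have := weight_ge0 b x0 x.
case: (x =P x0) => [->|_]; case: (y =P x0) => [->|_] /= *; nra.
Qed.

Lemma edge_bound u x y : finite_energy b u ->
  b x y * (u x - u y) ^+ 2 <= dirichlet u u.
Proof.
move=> /finite_energyP su.
have := term_le_tsum _ (x, y) (edge_prod_ge0 u) su.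
by rewrite {1}/edge_prod /= expr2 mulrA.
Qed.

(** Each edge z t of the path controls (u z - u t)^2 by E(u, u) / b(z, t), and
    (p + q)^2 <= 2 p^2 + 2 q^2 adds the steps up. The constant depends on the
    path only. *)
Lemma path_bound x s : path (fun z t => 0 < b z t) x s ->
  exists2 C, 0 <= C & forall u, finite_energy b u ->
    (u x - u (last x s)) ^+ 2 <= C * dirichlet u u.
Proof.
elim: s x => [|y s IH] x /=.
  by move=> _; exists 0 => // u _; rewrite subrr expr0n /= mul0r.
move=> /andP[bxy /IH[C C0 HC]].
exists (2 * ((b x y)^-1 + C)).
  by rewrite mulr_ge0 // addr_ge0 // invr_ge0 ltW.
move=> u fu; have := HC u fu.
have : (u x - u y) ^+ 2 <= (b x y)^-1 * dirichlet u u.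
  by rewrite ler_pdivlMl // edge_bound.
have -> : u x - u (last y s) = (u x - u y) + (u y - u (last y s)) by ring.
move: (u x - u y) (u y - u _) => d e h1 h2.
rewrite -mulrA mulrDl.
by have := sqr_ge0 (d - e); rewrite !expr2 in h1 h2 *; lra.
Qed.

Lemma connected_bound : connected_graph b ->
  forall o x, exists2 C, 0 <= C & forall u, finite_energy b u ->
    (u x - u o) ^+ 2 <= C * dirichlet u u.
Proof.
move=> con o x; have [s ps] := con x o.
have [C C0 HC] := path_bound _ _ ps.
by exists C => // u fu; have := HC u fu; rewrite last_rcons.
Qed.

Lemma dirichlet0_cst u : connected_graph b -> finite_energy b u ->
  dirichlet u u <= 0 -> forall x y, u x = u y.
Proof.
move=> con fu le x y; have [C C0 /(_ u fu)] := connected_bound con y x.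
have -> : dirichlet u u = 0 by apply/eqP; rewrite eq_le le dirichlet_ge0.
rewrite mulr0 => h; apply/eqP; rewrite -subr_eq0 -sqrf_eq0.
by rewrite eq_le h sqr_ge0.
Qed.

End Dirichlet.

(** * Uniform bounds on canonically compactifiable graphs *)

Section Bounds.
Context {R : realType} {X : countType}.
Variables (b : weighted_graph R X) (m : X -> R).
Hypothesis m_gt0 : forall x, 0 < m x.
Implicit Types (u v w : X -> R).

Lemma ell2P u : ell2 m u <-> abs_summable (fun x => u x ^+ 2 * m x).
Proof.
rewrite -ge0_abs_summable; last by move=> x; rewrite mulr_ge0 ?sqr_ge0 // ltW.
by rewrite /ell2 /=; under eq_esum do rewrite real_normK ?num_real //.
Qed.

(** The pointwise supremum U satisfies
    (U x - U y)^2 <= sup_n (w_n x - w_n y)^2 <= sum_n (w_n x - w_n y)^2, and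
    likewise U^2 <= sum_n w_n^2, so summable energies and norms pass to U. *)
Lemma sup_in_domQ (w : nat -> X -> R) (c : nat -> R) :
  (forall n x, 0 <= w n x) -> abs_summable c ->
  (forall n, finite_energy b (w n) /\ dirichlet b (w n) (w n) <= c n) ->
  (forall n, abs_summable (fun x => w n x ^+ 2 * m x) /\
    tsum (fun x => w n x ^+ 2 * m x) <= c n) ->
  exists2 U, domQ b m U & forall n x, w n x <= U x.
Proof.
move=> w0 sc wE wN.
have [sE1 sE2] := tsum_interchange_le (fun n => edge_prod b (w n) (w n)) c
  (fun n => edge_prod_ge0 b (w n))
  (fun n => conj ((finite_energyP b (w n)).1 (wE n).1) (wE n).2) sc.
have N0 n x : 0 <= w n x ^+ 2 * m x by rewrite mulr_ge0 ?sqr_ge0 // ltW.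
have [sN1 sN2] := tsum_interchange_le (fun n x => w n x ^+ 2 * m x) c N0 wN sc.
pose W x := Num.sqrt (tsum (fun n => w n x ^+ 2 * m x) / m x).
have wW n x : w n x <= W x.
  rewrite -[w n x]ger0_norm // -sqrtr_sqr ler_wsqrtr // ler_pdivlMr //.
  exact: (term_le_tsum _ n (fun k => N0 k x) (sN1 x)).
pose U x := sup (range (w^~ x)).
have wU n x : w n x <= U x.
  apply: ub_le_sup; last by exists n.
  by exists (W x) => _ [k _ <-].
have Ule x r : (forall n, w n x <= r) -> U x <= r.
  by move=> h; apply: ge_sup => [|_ [k _ <-] //]; exists (w 0%N x), 0%N.
exists U => //; split.
  apply/finite_energyP; apply: le_abs_summable sE2 => -[x y].
  rewrite ger0_norm ?edge_prod_ge0 //; set G := tsum _.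
  have G0 : 0 <= G by apply: tsum_ge0 => // n; exact: edge_prod_ge0.
  have [b0|bn0] := eqVneq (b x y) 0; first by rewrite /edge_prod /= b0 !mul0r.
  have bxy : 0 < b x y by rewrite lt_def bn0 weight_ge0.
  pose r := Num.sqrt (G / b x y).
  have wr n : `|w n x - w n y| <= r.
    rewrite -sqrtr_sqr ler_wsqrtr // ler_pdivlMr // mulrC expr2 mulrA.
    exact: (term_le_tsum _ n (fun k => edge_prod_ge0 b (w k) (x, y)) (sE1 (x, y))).
  have xy : U x <= U y + r.
    by apply: Ule => n; have := wr n; rewrite ler_norml; have := wU n y; lra.
  have yx : U y <= U x + r.
    by apply: Ule => n; have := wr n; rewrite ler_norml; have := wU n x; lra.
  rewrite /edge_prod /= -mulrA mulrC -ler_pdivlMr // -expr2.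
  rewrite -(sqr_sqrtr (divr_ge0 G0 (ltW bxy))) -/r -(real_normK (num_real (_ - _))).
  rewrite lerXn2r ?nnegrE ?sqrtr_ge0 // ler_norml.
  by apply/andP; split; lra.
apply/ell2P; apply: le_abs_summable sN2 => x.
rewrite ger0_norm; last by rewrite mulr_ge0 ?sqr_ge0 // ltW.
rewrite -ler_pdivlMr //.
have H0 : 0 <= tsum (fun n => w n x ^+ 2 * m x) / m x.
  by apply: divr_ge0; [exact: tsum_ge0|exact: ltW].
rewrite -(sqr_sqrtr H0) lerXn2r ?nnegrE ?sqrtr_ge0 //.
  exact: le_trans (w0 0%N x) (wU 0%N x).
by apply: Ule => n; exact: wW.
Qed.

Hypothesis m_fin : (vol m [set: X] < +oo)%E.

Lemma m_summable : abs_summable m.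
Proof. by apply: (ge0_abs_summable _ _).1 => // x; exact: ltW. Qed.

(** Functions bounded by n contribute little to the norm outside a finite set
    that carries almost all of the mass of X, and on that finite set a small
    energy forces small values by connectedness. *)
Lemma small_energy_small_norm (o : X) (n d : R) : connected_graph b -> 0 < d ->
  exists2 e, 0 < e & forall w, finite_energy b w -> w o = 0 ->
    (forall x, `|w x| <= n) -> dirichlet b w w <= e ->
    abs_summable (fun x => w x ^+ 2 * m x) /\ tsum (fun x => w x ^+ 2 * m x) <= d.
Proof.
move=> con d0.
have m0 x : 0 <= m x by exact: ltW.
have n1 : 0 < 2 * (n ^+ 2 + 1) by have := sqr_ge0 n; lra.
have [s us tail] := summable_tail_small _ _ m0 m_summable (divr_gt0 d0 n1).
have /choice[C HC] : forall x, exists C, 0 <= C /\ forall u, finite_energy b u ->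
    (u x - u o) ^+ 2 <= C * dirichlet b u u.
  by move=> x; have [C C0 H] := connected_bound b con o x; exists C.
pose K := \sum_(x <- s) C x * m x.
have Cm0 x : 0 <= C x * m x by rewrite mulr_ge0 // (HC x).1.
have K0 : 0 <= K by apply: sumr_ge0.
have K1 : 0 < 2 * (K + 1) by lra.
exists (d / (2 * (K + 1))); first exact: divr_gt0.
move=> w fw wo wn; set e := d / (2 * _) => wE.
have e0 : 0 <= e by rewrite divr_ge0 ?ltW.
apply: tsum_le => [x|t ut]; first by rewrite mulr_ge0 ?sqr_ge0.
rewrite (bigID (mem s)) /=.
have -> : d = d / 2 + d / 2 by lra.
apply: lerD.
  apply: (@le_trans _ _ (\sum_(x <- t | x \in s) e * (C x * m x))).
    apply: ler_sum => x _; rewrite mulrA ler_wpM2r //.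
    have := (HC x).2 w fw; rewrite wo subr0 => /le_trans; apply.
    by rewrite mulrC ler_wpM2r // (HC x).1.
  rewrite -mulr_sumr -big_filter.
  apply: (@le_trans _ _ (e * K)).
    rewrite ler_wpM2l //; apply: ler_sum_subset => //; first exact: filter_uniq.
    by move=> x; rewrite mem_filter => /andP[].
  rewrite /e mulrAC ler_pdivrMr //.
  by rewrite mulrA divfK // ler_pM2l //; lra.
apply: (@le_trans _ _ (\sum_(x <- t | x \notin s) n ^+ 2 * m x)).
  apply: ler_sum => x _; rewrite ler_wpM2r // -(real_normK (num_real (w x))).
  by rewrite lerXn2r ?nnegrE // (le_trans _ (wn x)).
rewrite -mulr_sumr -big_filter.
apply: (@le_trans _ _ (n ^+ 2 * (d / (2 * (n ^+ 2 + 1))))).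
  rewrite ler_wpM2l ?sqr_ge0 //; apply: tail; first by rewrite filter_uniq.
  by move=> x; rewrite mem_filter => /andP[].
rewrite mulrA ler_pdivrMr // mulrA divfK // mulrC ler_pM2l //.
by lra.
Qed.

(** If no constant worked, rescaling and truncating the counterexamples would
    give w_n >= 0 reaching the value n with energy and squared norm at most
    2^-n. Their supremum would be an unbounded element of D(Q). This replaces an
    appeal to the closed graph theorem. *)
Lemma uniform_bound (o : X) : canonically_compactifiable b m ->
  exists2 C, 0 <= C & forall u, finite_energy b u ->
    forall x, (u x - u o) ^+ 2 <= C * dirichlet b u u.
Proof.
move=> [con cc]; apply: contrapT => nC.
have p0 n : 0 < (2^-1 : R) ^+ n by rewrite exprn_gt0 // invr_gt0.
have step n : exists w : X -> R, [/\ forall x, 0 <= w x,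
    finite_energy b w /\ dirichlet b w w <= 2^-1 ^+ n,
    abs_summable (fun x => w x ^+ 2 * m x) /\
      tsum (fun x => w x ^+ 2 * m x) <= 2^-1 ^+ n
    & exists x, w x = n%:R].
  have n0 : 0 <= n%:R :> R by [].
  have [e0 e0_gt0 He] := small_energy_small_norm o n%:R _ con (p0 n).
  pose e := Num.min e0 (2^-1 ^+ n).
  have e_gt0 : 0 < e by rewrite lt_min e0_gt0 p0.
  (* With this C the rescaled counterexample has energy at most e. *)
  pose C := n%:R ^+ 2 / e.
  have C0 : 0 <= C by rewrite divr_ge0 ?sqr_ge0 // ltW.
  have [u [fu [x ltx]]] : exists u, finite_energy b u /\
      exists x, C * dirichlet b u u < (u x - u o) ^+ 2.
    apply: contrapT => nu; apply: nC; exists C => // u fu x.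
    rewrite leNgt; apply/negP => lt; apply: nu.
    by exists u; split => //; exists x.
  have d0 : 0 < `|u x - u o|.
    rewrite normr_gt0; apply: contraTneq ltx => ->.
    by rewrite expr0n /= -leNgt mulr_ge0 // dirichlet_ge0.
  set d := `|u x - u o| in d0.
  pose w y := Num.min (n%:R / d * `|u y - u o|) n%:R.
  have k0 : 0 <= n%:R / d by rewrite divr_ge0 // ltW.
  have w_ge0 y : 0 <= w y by rewrite le_min mulr_ge0.
  have lip y z : `|w y - w z| <= n%:R / d * `|u y - u z|.
    have tri : `| `|u y - u o| - `|u z - u o| | <= `|u y - u z|.
      apply: le_trans (ler_dist_dist _ _) _.
      by rewrite opprB addrA subrK.
    have := ler_wpM2l k0 tri; rewrite -[X in X * _ <= _](ger0_norm k0) -normrM mulrBr.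
    rewrite /w; set p := _ * `|u y - _|; set q := _ * `|u z - _|.
    rewrite ler_norml => /andP[h1 h2]; rewrite ler_norml.
    by rewrite /Num.min; case: ifP => c1; case: ifP => c2; apply/andP; split; lra.
  have [fw Ew] := lipschitz_energy b _ u w k0 lip fu.
  have Ewe : dirichlet b w w <= e.
    apply: le_trans Ew _; rewrite expr_div_n mulrAC ler_pdivrMr ?exprn_gt0 //.
    have : n%:R ^+ 2 = e * C by rewrite /C mulrC divfK // gt_eqF.
    move=> ->; rewrite -mulrA ler_wpM2l ?ltW //.
    by rewrite /d real_normK ?num_real.
  have wn y : `|w y| <= n%:R by rewrite ger0_norm // ge_min lexx orbT.
  have wo : w o = 0 by rewrite /w subrr normr0 mulr0; apply/min_idPl.
  exists w; split => //.
  - by split => //; apply: le_trans Ewe _; rewrite ge_min lexx orbT.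
  - by apply: He => //; apply: le_trans Ewe _; rewrite ge_min lexx.
  - by exists x; rewrite /w -/d divfK ?gt_eqF // minxx.
have [w Hw] := choice step.
have [||n|n|U domU wU] := sup_in_domQ w (fun n => 2^-1 ^+ n).
- by move=> n; case: (Hw n).
- exact: abs_summable_geometric.
- by case: (Hw n).
- by case: (Hw n).
have [M HM] := cc _ domU.
have [_ _ _ [x wx]] := Hw (Num.bound `|M|).
have := wU (Num.bound `|M|) x; rewrite wx.
have := archi_boundP (normr_ge0 M).
have := HM x; have := ler_norm (U x); have := ler_norm M; lra.
Qed.

End Bounds.

(** * Limits along ultrafilters, exponential estimates, multipliers *)

(** F decides the preimage of every set, so the image filter decides every set
    and has no proper extension. *)
Lemma ultra_fmap {T U : Type} (f : T -> U) (F : set_system T) :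
  UltraFilter F -> UltraFilter (f @ F).
Proof.
move=> FU; split=> [|G GF sFG]; first exact: fmap_proper_filter.
rewrite predeqE => A; split => [GA|]; last exact: sFG.
have [//|FnA] := in_ultra_setVsetC (f @^-1` A) FU.
have GnA : G (~` A) by exact: sFG.
by have /filter_ex[? []] : G (A `&` ~` A) by exact: filterI.
Qed.

Lemma ultra_bounded_cvg {R : realType} {T : Type} (F : set_system T)
    (f : T -> R) (K : R) :
  UltraFilter F -> (forall t, `|f t| <= K) -> exists l : R, f t @[t --> F] --> l.
Proof.
move=> FU fK; have := @segment_compact R (- K) K.
rewrite compact_ultra => /(_ _ (ultra_fmap f F FU))[|l [_ fl]]; last by exists l.
apply: (@filterS _ F _ setT) => [t _|]; last exact: filterT.
by rewrite /= in_itv /= -ler_norml.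
Qed.

(** Fatou's lemma along an arbitrary proper filter; only finite partial sums have
    to converge. *)
Lemma tsum_fatou {R : realType} {I : choiceType} {T : Type} (F : set_system T)
    (f : T -> I -> R) (g : I -> R) (c : R) : ProperFilter F ->
  (forall t i, 0 <= f t i) -> (forall t, abs_summable (f t)) ->
  (forall i, f t i @[t --> F] --> g i) ->
  (forall e, 0 < e -> \forall t \near F, tsum (f t) <= c + e) ->
  abs_summable g /\ tsum g <= c.
Proof.
move=> FF f0 sf fg fc; apply: tsum_le => [i|s us].
  by apply: (cvgr_to_ge (fg i)); apply: filterS filterT => t _; exact: f0.
apply/ler_addgt0Pr => e /fc fce.
have fgs : \sum_(i <- s) f t i @[t --> F] --> \sum_(i <- s) g i.
  by apply: (@cvg_big _ _ +%R 0 xpredT) => // ?; exact: add_continuous.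
apply: (cvgr_to_le fgs); apply: filterS fce => t; apply: le_trans.
exact: sum_le_tsum.
Qed.

(** The upper half follows from [1 - x <= expR (- x)], which bounds [expR x] by
    1 / (1 - x). *)
Lemma expR_le_quadratic {R : realType} (x : R) : `|x| <= 2^-1 ->
  `|expR x - (1 + x)| <= 2 * x ^+ 2.
Proof.
rewrite ler_norml => /andP[x1 x2].
have lo := expR_ge1Dx x.
have hi : expR x * (1 - x) <= 1.
  rewrite -[leRHS](expRxMexpNx_1 x) ler_wpM2l ?expR_ge0 //.
  exact: expR_ge1Dx.
rewrite ger0_norm ?subr_ge0 // lerBlDl.
have x0 : 0 < 1 - x by lra.
rewrite -(ler_pM2r x0); apply: le_trans hi _; rewrite expr2; nra.
Qed.

Lemma expR_lipschitz {R : realType} (K x y : R) : x <= K -> y <= K ->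
  `|expR x - expR y| <= expR K * `|x - y|.
Proof.
wlog xy : x y / y <= x => [H xK yK|xK yK].
  have /orP[yx|yx] := le_total y x; first exact: H.
  by rewrite distrC (distrC x); exact: H.
rewrite !ger0_norm ?subr_ge0 ?ler_expR //.
apply: (@le_trans _ _ (expR x * (x - y))); last first.
  by rewrite ler_wpM2r ?subr_ge0 // ler_expR.
have := ler_wpM2l (expR_ge0 x) (expR_ge1Dx (y - x)).
by rewrite -expRD [x + _]addrC subrK; lra.
Qed.

(** On the kernel of l, adding a small multiple of w shows B >= 0, and the kernel
    is symmetric, so B vanishes there. Hence B factors through l, and its value
    at w fixes the nonnegative factor. *)
Lemma lagrange_multiplier_halfspace {R : realType} {V : Type} (D : set (V -> R))
    (B l : (V -> R) -> R) (w : V -> R) :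
  (forall c u v, D u -> D v -> D (fun x => u x + c * v x)) ->
  (forall c u v, D u -> D v -> B (fun x => u x + c * v x) = B u + c * B v) ->
  (forall c u v, D u -> D v -> l (fun x => u x + c * v x) = l u + c * l v) ->
  (forall v, D v -> 0 < l v -> 0 <= B v) -> D w -> 0 < l w ->
  exists2 a, 0 <= a & forall v, D v -> B v = a * l v.
Proof.
move=> DD BL lL pos Dw lw; exists (B w / l w).
  by rewrite divr_ge0 ?pos // ltW.
have ker v : D v -> l v = 0 -> 0 <= B v.
  move=> Dv lv; apply/ler_addgt0Pr => e e0.
  have Bw : 0 < B w + 1 by have := pos w Dw lw; lra.
  have k0 : 0 < e / (B w + 1) by exact: divr_gt0.
  have := pos _ (DD (e / (B w + 1)) _ _ Dv Dw).
  rewrite lL // BL // lv add0r mulr_gt0 // => /(_ isT).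
  move=> /le_trans; apply; rewrite lerD2l mulrAC ler_pdivrMr //.
  by rewrite ler_pM2l //; lra.
move=> v Dv; pose k := - (l v / l w).
pose z x := v x + k * w x.
have Dz : D z by exact: DD.
have lz : l z = 0 by rewrite lL // /k mulNr divfK ?subrr // gt_eqF.
(* The space is only closed under x + c y, so -z is written z - 2 z. *)
pose z' x := z x + (- 2) * z x.
have Dz' : D z' by exact: DD.
have lz' : l z' = 0 by rewrite lL // lz; ring.
have := ker _ Dz lz; have := ker _ Dz' lz'.
rewrite BL // => h1 h2.
have : B z = 0 by lra.
rewrite BL // /k => h.
have -> : B w / l w * l v = l v / l w * B w by ring.
lra.
Qed.

(** * The constrained minimisation problem *)

Section Variational.
Context {R : realType} {X : countType}.
Variables (b : weighted_graph R X) (m h : X -> R).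
Hypothesis m_gt0 : forall x, 0 < m x.
Hypothesis m_fin : (vol m [set: X] < +oo)%E.
Hypothesis cc : canonically_compactifiable b m.
Hypothesis h_ell2 : ell2 m h.
Implicit Types (u v w : X -> R).

Let m_ge0 x : 0 <= m x. Proof. exact: ltW. Qed.

Lemma domQ_bounded u : domQ b m u -> exists2 K, 0 <= K & forall x, `|u x| <= K.
Proof.
move=> du; have [M HM] := cc.2 u du.
by exists `|M| => // x; apply: le_trans (HM x) (ler_norm _).
Qed.

Lemma bounded_ell2 u K : (forall x, `|u x| <= K) -> ell2 m u.
Proof.
move=> uK; apply/ell2P => //.
apply: (le_abs_summable _ (fun x => K ^+ 2 * m x)); last first.
  by apply: abs_summableZ; exact: m_summable.
move=> x; rewrite normrM (ger0_norm (m_ge0 x)) ler_wpM2r // normrX.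
by rewrite lerXn2r ?nnegrE // (le_trans _ (uK x)).
Qed.

Lemma bounded_domQ u K : finite_energy b u -> (forall x, `|u x| <= K) -> domQ b m u.
Proof. by move=> fu uK; split => //; exact: bounded_ell2 uK. Qed.

Lemma domQ_addM c u v : domQ b m u -> domQ b m v -> domQ b m (fun x => u x + c * v x).
Proof.
move=> du dv; have [K K0 uK] := domQ_bounded _ du.
have [K' K'0 vK] := domQ_bounded _ dv.
apply: (bounded_domQ _ (K + `|c| * K')).
  by apply: finite_energyD; [exact: du.1|apply: finite_energyZ; exact: dv.1].
move=> x; apply: le_trans (ler_normD _ _) _; rewrite normrM.
by apply: lerD => //; exact: ler_wpM2l.
Qed.

Lemma finite_energy_cst c : finite_energy b (fun=> c : R).
Proof.
apply/finite_energyP; have := @abs_summable0 R (X * X)%type.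
by congr abs_summable; apply/funext => p; rewrite /edge_prod subrr !mulr0.
Qed.

Lemma domQ_cst c : domQ b m (fun=> c : R).
Proof. exact: (bounded_domQ _ `|c| (finite_energy_cst c)). Qed.

Lemma domQ_indic x0 : domQ b m (fun x => (x == x0)%:R).
Proof.
apply: (bounded_domQ _ 1 (finite_energy_indic b x0)) => x.
by case: (x == x0); rewrite ?normr1 // normr0.
Qed.

Lemma ell2_summable : abs_summable (fun x => h x * m x).
Proof.
have /ell2P sh := h_ell2.
apply: le_abs_summable (abs_summableD _ _ (sh m_gt0) (m_summable _ m_gt0 m_fin)).
move=> x; rewrite normrM (ger0_norm (m_ge0 x)) -[X in _ + X]mul1r -mulrDl ler_wpM2r //.
have := norm_mul_le_sum_sq (h x) 1; rewrite mulr1 expr2; lra.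
Qed.

Lemma weighted_summable g K : (forall x, `|g x| <= K) ->
  abs_summable (fun x => h x * g x * m x).
Proof.
move=> gK.
apply: le_abs_summable (abs_summableZ K _ (abs_summable_norm _ ell2_summable)) => x.
by rewrite mulrAC normrM mulrC ler_wpM2r.
Qed.

Lemma expR_bounded u : domQ b m u -> exists K, forall x, `|expR (u x)| <= K.
Proof.
move=> du; have [K K0 uK] := domQ_bounded _ du; exists (expR K) => x.
by rewrite ger0_norm ?expR_ge0 // ler_expR (le_trans (ler_norm _)).
Qed.

Definition exp_pairing u v : R := tsum (fun x => h x * expR (u x) * v x * m x).

Lemma exp_pairing_summable u v : domQ b m u -> domQ b m v ->
  abs_summable (fun x => h x * expR (u x) * v x * m x).
Proof.
move=> du dv; have [K HK] := expR_bounded _ du; have [M M0 HM] := domQ_bounded _ dv.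
suff : abs_summable (fun x => h x * (expR (u x) * v x) * m x).
  by congr abs_summable; apply/funext => x; rewrite mulrA.
by apply: (weighted_summable _ (K * M)) => x; rewrite normrM ler_pM.
Qed.

Lemma exp_pairing_addM u c v w : domQ b m u -> domQ b m v -> domQ b m w ->
  exp_pairing u (fun x => v x + c * w x) = exp_pairing u v + c * exp_pairing u w.
Proof.
move=> du dv dw; rewrite /exp_pairing -tsumZ; last exact: exp_pairing_summable.
rewrite -tsumD; [|exact: exp_pairing_summable|].
  by congr tsum; apply/funext => x; ring.
by apply: abs_summableZ; exact: exp_pairing_summable.
Qed.

Lemma exp_pairing_shift c u v : domQ b m u -> domQ b m v ->
  exp_pairing (fun x => u x + c) v = expR c * exp_pairing u v.
Proof.
move=> du dv; rewrite /exp_pairing -tsumZ; last exact: exp_pairing_summable.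
by congr tsum; apply/funext => x; rewrite expRD; ring.
Qed.

Lemma exp_pairing_indic u x0 :
  exp_pairing u (fun x => (x == x0)%:R) = h x0 * expR (u x0) * m x0.
Proof.
rewrite /exp_pairing (@tsum_single _ _ _ x0) ?eqxx ?mulr1 //.
by move=> x /negPf ->; rewrite mulr0 mul0r.
Qed.

(** The constraint <h, e^u> >= 0 is an inequality on purpose: a direction that
    increases it may then be followed freely, with no correction term. *)
Definition feasible u : Prop := domQ b m u /\ 0 <= exp_pairing u (fun=> 1).

(** A high enough peak at a point where h is positive makes <h, e^u>
    nonnegative. *)
Lemma feasible_exists x0 : 0 < h x0 -> exists u, feasible u.
Proof.
move=> hx0; have hm0 : 0 < h x0 * m x0 by exact: mulr_gt0.
pose S := exp_pairing (fun=> 0) (fun=> 1).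
pose t := `|S| / (h x0 * m x0).
have t0 : 0 <= t by rewrite divr_ge0 // ltW.
have du : domQ b m (fun x => 0 + t * (x == x0)%:R).
  by apply: domQ_addM; [exact: domQ_cst|exact: domQ_indic].
exists (fun x => 0 + t * (x == x0)%:R); split => //.
pose e x := h x * expR 0 * 1 * m x.
pose d x : R := (expR t - 1) * (h x * (x == x0)%:R * m x).
have d0 x : x != x0 -> d x = 0 by rewrite /d => /negPf ->; rewrite mulr0 mul0r mulr0.
have -> : exp_pairing (fun x => 0 + t * (x == x0)%:R) (fun=> 1) = S + tsum d.
  rewrite -tsumD; last exact: abs_summable_single d0.
    congr tsum; apply/funext => x; rewrite /d expR0 add0r.
    by case: (x == x0); rewrite ?mulr1 ?mulr0 ?expR0; ring.
  by apply: exp_pairing_summable; exact: domQ_cst.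
rewrite (tsum_single _ _ d0) /d eqxx mulr1.
have et : t <= expR t - 1 by have := expR_ge1Dx t; lra.
have := ler_wpM2r (ltW hm0) et; rewrite {1}/t divfK ?gt_eqF //.
have := ler_norm (- S); rewrite normrN; lra.
Qed.

(** The direct method. The minimising sequence is pinned at [x0] to make it
    uniformly bounded, and a pointwise limit along an ultrafilter replaces the
    extraction of a subsequence. *)
Lemma minimizer_exists x0 : 0 < h x0 ->
  exists2 u, feasible u & forall v, feasible v -> dirichlet b u u <= dirichlet b v v.
Proof.
move=> hx0; have [ua fa] := feasible_exists _ hx0.
pose E : set R := [set r | exists2 u, feasible u & dirichlet b u u = r].
have lbE : has_lbound E.
  by exists 0 => _ [u fu <-]; apply: dirichlet_ge0; exact: fu.1.1.
have E0 : E !=set0 by exists (dirichlet b ua ua), ua.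
pose I := inf E.
have Ile u : feasible u -> I <= dirichlet b u u by move=> fu; apply: ge_inf => //; exists u.
have I0 : 0 <= I.
  by apply: lb_le_inf => // _ [u fu <-]; apply: dirichlet_ge0; exact: fu.1.1.
have [C C0 HC] := uniform_bound b m m_gt0 m_fin x0 cc.
have step n : exists u, [/\ feasible u, u x0 = 0 & dirichlet b u u < I + n.+1%:R^-1].
  have n1 : 0 < n.+1%:R^-1 :> R by rewrite invr_gt0.
  have [_ [u [du Gu] <-] ltu] := inf_adherent n1 (conj E0 lbE).
  have dw : domQ b m (fun x => u x + (- u x0)).
    have := domQ_addM 1 _ _ du (domQ_cst (- u x0)).
    by under eq_fun do rewrite mul1r.
  exists (fun x => u x + (- u x0)); split.
  - split => //; rewrite exp_pairing_shift // ?mulr_ge0 ?expR_ge0 //.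
    exact: domQ_cst.
  - by rewrite subrr.
  - by rewrite (dirichlet_eq _ _ u _ u) // => x y; ring.
have [us Hus] := choice step.
pose K := Num.sqrt (C * (I + 1)).
have usK x n : `|us n x| <= K.
  have [fu u0 lt] := Hus n.
  rewrite -sqrtr_sqr ler_wsqrtr //.
  have := HC _ fu.1.1 x; rewrite u0 subr0 => /le_trans; apply.
  rewrite ler_wpM2l // (le_trans (ltW lt)) // lerD2l.
  by rewrite invf_le1 // ler1n.
have [U [UU sU]] := ultraFilterLemma eventually_filter.
have [u Hu] := choice (fun x => ultra_bounded_cvg U (us^~ x) K UU (usK x)).
have uK x : `|u x| <= K.
  apply: (cvgr_to_le (cvg_norm (Hu x))).
  by apply: filterS filterT => n _.
have [fu Eu] : abs_summable (edge_prod b u u) /\ tsum (edge_prod b u u) <= I.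
  apply: (tsum_fatou U (fun n => edge_prod b (us n) (us n))).
  - by move=> n p; exact: edge_prod_ge0.
  - by move=> n; apply/finite_energyP; case: (Hus n) => -[[]].
  - move=> p; rewrite /edge_prod.
    by apply: cvgM; [apply: cvgMl_tmp|]; apply: cvgB.
  - move=> e e0; apply: sU.
    exists (Num.bound e^-1) => // n /= len.
    have [_ _ /ltW /le_trans] := Hus n; apply; rewrite lerD2l.
    have ei : 0 <= e^-1 by rewrite invr_ge0 ltW.
    rewrite invf_ple ?posrE //; apply: (le_trans (ltW (archi_boundP ei))).
    by rewrite ler_nat (leq_trans len).
have du : domQ b m u by apply: (bounded_domQ _ K) => //; apply/finite_energyP.
exists u; last by move=> v fv; apply: le_trans Eu (Ile v fv).
split => //.
(* A dominates h e^{u_n} m for all n, so Fatou's lemma applied to the nonnegative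
   A - h e^{u_n} m gives upper semicontinuity of <h, e^u>. *)
pose A x := `|h x| * expR K * 1 * m x.
have sA : abs_summable A.
  have := abs_summableZ (expR K) _ (abs_summable_norm _ ell2_summable).
  congr abs_summable; apply/funext => x; rewrite /A normrM (ger0_norm (m_ge0 x)); ring.
pose f w x := A x - h x * expR (w x) * 1 * m x.
have f0 w : (forall x, `|w x| <= K) -> forall x, 0 <= f w x.
  move=> wK x; rewrite subr_ge0 /A ler_wpM2r // !mulr1.
  apply: (@le_trans _ _ (`|h x| * expR (w x))).
    by rewrite ler_wpM2r ?expR_ge0 // ler_norm.
  by rewrite ler_wpM2l // ler_expR (le_trans (ler_norm _)).
have tf w : domQ b m w -> abs_summable (f w) /\
    tsum (f w) = tsum A - exp_pairing w (fun=> 1).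
  move=> dw; have sw := exp_pairing_summable w _ dw (domQ_cst 1).
  by split; [exact: abs_summableB|rewrite /f tsumB].
have [_] : abs_summable (f u) /\ tsum (f u) <= tsum A.
  apply: (tsum_fatou U (fun n => f (us n))).
  - by move=> n; apply: f0 => x.
  - by move=> n; apply: (tf _ _).1; case: (Hus n) => -[].
  - move=> x; apply: cvgB; first exact: cvg_cst.
    apply: cvgMr_tmp; apply: cvgMr_tmp; apply: cvgMl_tmp.
    exact: (continuous_cvg _ (@continuous_expR R (u x)) (Hu x)).
  - move=> e e0; apply: filterS filterT => n _.
    have [[dn Gn] _ _] := Hus n.
    by rewrite (tf _ dn).2; lra.
by rewrite (tf _ du).2; lra.
Qed.

(** The first-order Taylor expansion of <h, e^(u + t v)> at t = 0, with an error
    uniform on X since u and v are bounded. *)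
Lemma exp_pairing_expand u v : domQ b m u -> domQ b m v ->
  exists2 e, 0 < e & exists2 H, 0 <= H & forall t, 0 <= t -> t <= e ->
    exp_pairing u (fun=> 1) + t * exp_pairing u v - t ^+ 2 * H
    <= exp_pairing (fun x => u x + t * v x) (fun=> 1).
Proof.
move=> du dv; have [K K0 vK] := domQ_bounded _ dv.
have k0 : 0 < 2 * (K + 1) by lra.
exists (2 * (K + 1))^-1; first by rewrite invr_gt0.
have d1 := domQ_cst 1.
pose N x := `|h x * expR (u x) * 1 * m x|.
have sN : abs_summable N by apply: abs_summable_norm; exact: exp_pairing_summable.
exists (2 * K ^+ 2 * tsum N).
  by apply: mulr_ge0; [rewrite mulr_ge0 ?sqr_ge0|apply: tsum_ge0 => // x; exact: normr_ge0].
move=> t t0 te.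
have -> : t ^+ 2 * (2 * K ^+ 2 * tsum N) = t ^+ 2 * (2 * K ^+ 2) * tsum N by ring.
have su := exp_pairing_summable _ _ du d1.
have suv := abs_summableZ t _ (exp_pairing_summable _ _ du dv).
have sNt := abs_summableZ (t ^+ 2 * (2 * K ^+ 2)) _ sN.
rewrite -[t * exp_pairing _ _]tsumZ; last exact: exp_pairing_summable.
rewrite -[_ * tsum N]tsumZ // -tsumD // -tsumB //; last exact: abs_summableD.
apply: ler_tsum; first by apply: abs_summableB => //; exact: abs_summableD.
  by apply: exp_pairing_summable => //; exact: domQ_addM.
move=> x; rewrite /N expRD.
have tvK : `|t * v x| <= t * K by rewrite normrM (ger0_norm t0) ler_wpM2l.
have tK : t * K <= 2^-1.
  apply: (@le_trans _ _ ((2 * (K + 1))^-1 * K)); first by rewrite ler_wpM2r.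
  by rewrite mulrC ler_pdivrMr //; lra.
have := expR_le_quadratic _ (le_trans tvK tK).
have tv2 : (t * v x) ^+ 2 <= t ^+ 2 * K ^+ 2.
  by rewrite -exprMn -(real_normK (num_real (t * v x))) lerXn2r ?nnegrE // mulr_ge0.
set a := h x * expR (u x) * 1 * m x; set q := expR _ - _ => qle.
have q2 : `|q| <= t ^+ 2 * (2 * K ^+ 2) by lra.
have : `|a * q| <= t ^+ 2 * (2 * K ^+ 2) * `|a|.
  by rewrite normrM mulrC ler_wpM2r.
rewrite ler_norml => /andP[lo _].
have -> : h x * (expR (u x) * expR (t * v x)) * 1 * m x =
    a + t * (h x * expR (u x) * v x * m x) + a * q.
  by rewrite /a /q; ring.
lra.
Qed.

(** For small t > 0 the linear term dominates both quadratic errors: u + t v is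
    feasible, and E(u, v) < 0 would make its energy smaller than that of u. *)
Lemma first_variation u v : feasible u ->
  (forall w, feasible w -> dirichlet b u u <= dirichlet b w w) ->
  domQ b m v -> 0 < exp_pairing u v -> 0 <= dirichlet b u v.
Proof.
move=> [du Gu] umin dv lv; rewrite leNgt; apply/negP => Buv.
have [e e0 [H H0 exH]] := exp_pairing_expand _ _ du dv.
have Dv0 : 0 <= dirichlet b v v by apply: dirichlet_ge0; exact: dv.1.
have H1 : 0 < H + 1 by lra.
have D1 : 0 < dirichlet b v v + 1 by lra.
pose t := Num.min e (Num.min (exp_pairing u v / (H + 1))
                             (- dirichlet b u v / (dirichlet b v v + 1))).
have t0 : 0 < t by rewrite !lt_min e0 !divr_gt0 // oppr_gt0.
have te : t <= e by rewrite !ge_min lexx.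
have t1 : t * (H + 1) <= exp_pairing u v.
  by rewrite -ler_pdivlMr // !ge_min lexx orbT.
have t2 : t * (dirichlet b v v + 1) <= - dirichlet b u v.
  by rewrite -ler_pdivlMr // !ge_min lexx !orbT.
have fw : feasible (fun x => u x + t * v x).
  split; first exact: domQ_addM.
  apply: le_trans (exH t (ltW t0) te).
  have : t * (t * (H + 1)) <= t * exp_pairing u v by rewrite ler_pM2l.
  have := sqr_ge0 t; rewrite expr2; lra.
have := umin _ fw; rewrite dirichlet_square; [|exact: du.1|exact: dv.1].
have : t * (t * (dirichlet b v v + 1)) <= t * - dirichlet b u v by rewrite ler_pM2l.
have := sqr_ge0 t; have : t * dirichlet b u v < 0 by rewrite pmulr_rlt0.
rewrite expr2; lra.
Qed.

(** The multiplier is not 0: otherwise E(u, u) = 0, so u is constant and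
    <h, e^u> has the sign of <h, 1>. *)
Lemma euler_lagrange x0 : 0 < h x0 -> tsum (fun x => h x * m x) < 0 ->
  exists u a, [/\ domQ b m u, 0 < a &
    forall v, domQ b m v -> dirichlet b u v = a * exp_pairing u v].
Proof.
move=> hx0 hneg; have [u fu umin] := minimizer_exists _ hx0.
have du := fu.1.
have [||||||a a0 Ha] := lagrange_multiplier_halfspace (domQ b m) (dirichlet b u)
  (exp_pairing u) (fun x => (x == x0)%:R).
- by move=> *; exact: domQ_addM.
- move=> c v w dv dw; rewrite dirichletDr ?dirichletZr //.
  + exact: du.1.
  + exact: dw.1.
  + exact: du.1.
  + exact: dv.1.
  + by apply: finite_energyZ; exact: dw.1.
- by move=> *; exact: exp_pairing_addM.
- by move=> v; exact: first_variation.
- exact: domQ_indic.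
- by rewrite exp_pairing_indic !mulr_gt0 ?expR_gt0.
exists u, a; split => //.
rewrite lt_def a0 andbT; apply/eqP => az.
have uu : dirichlet b u u <= 0 by rewrite Ha // az mul0r.
have uc := dirichlet0_cst b u cc.1 du.1 uu.
have := fu.2; rewrite leNgt => /negP; apply.
have -> : exp_pairing u (fun=> 1) = expR (u x0) * tsum (fun x => h x * m x).
  rewrite -tsumZ; last exact: ell2_summable.
  by congr tsum; apply/funext => x; rewrite (uc x x0); ring.
by rewrite pmulr_rlt0 // expR_gt0.
Qed.

End Variational.

(** * The equation Lu = h e^u *)

Section Equation.
Context {R : realType} {X : countType}.
Variables (b : weighted_graph R X) (m h : X -> R).
Hypothesis m_gt0 : forall x, 0 < m x.
Hypothesis m_fin : (vol m [set: X] < +oo)%E.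
Hypothesis cc : canonically_compactifiable b m.
Hypothesis h_ell2 : ell2 m h.
Implicit Types (u v w : X -> R).

Lemma mean_lt0E (x0 : X) : (mean m h < 0) = (tsum (fun x => h x * m x) < 0).
Proof.
have sm := m_summable m m_gt0 m_fin.
have m0 x : 0 <= m x by exact: ltW.
rewrite /mean /vol abs_summable_tsum //= pmulr_rlt0.
  by congr (_ < _); congr tsum; apply/funext => x; rewrite mulr1.
by rewrite invr_gt0; apply: lt_le_trans (m_gt0 x0) (term_le_tsum _ x0 m0 sm).
Qed.

(** Testing against the indicator of a point determines the value there. *)
Lemma represents_unique u f g : represents_Q b m u f -> represents_Q b m u g -> f = g.
Proof.
move=> [_ Hf] [_ Hg]; apply/funext => x0.
have d0 := domQ_indic b m m_gt0 m_fin x0.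
have ind k : inner m k (fun x => (x == x0)%:R) = k x0 * m x0.
  rewrite /inner (@tsum_single _ _ _ x0) ?eqxx ?mulr1 //.
  by move=> x /negPf ->; rewrite mulr0 mul0r.
have := Hf _ d0; rewrite (Hg _ d0) !ind => /esym; apply: mulIf.
by rewrite gt_eqF.
Qed.

Lemma laplacianE u f : represents_Q b m u f -> laplacian b m u = f.
Proof.
move=> rf; apply: (represents_unique u) => //.
by rewrite /laplacian; apply: (@xgetPex _ (cst 0) [set f | represents_Q b m u f]); exists f.
Qed.

Lemma solution_pairing u : domL b m u ->
  laplacian b m u = (fun x => h x * expR (u x)) ->
  forall v, domQ b m v -> 2^-1 * dirichlet b u v = exp_pairing m h u v.
Proof.
move=> [_ [f rf]]; rewrite (laplacianE _ _ rf) => fE v dv.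
by move: (rf.2 v dv); rewrite fE.
Qed.

Lemma domQ_expN u : domQ b m u -> domQ b m (fun x => expR (- u x)).
Proof.
move=> du; have [K K0 uK] := domQ_bounded b m cc _ du.
have NuK x : - u x <= K by apply: le_trans (ler_norm _) _; rewrite normrN.
apply: (bounded_domQ b m m_gt0 m_fin _ (expR K)).
  apply: (lipschitz_energy b (expR K) u _ _ _ du.1).1; first exact: expR_ge0.
  move=> x y; apply: le_trans (expR_lipschitz K _ _ (NuK x) (NuK y)) _.
  by rewrite -opprD normrN.
by move=> x; rewrite ger0_norm ?expR_ge0 // ler_expR.
Qed.

Lemma sub_mul_expN_le0 (s t : R) : (s - t) * (expR (- s) - expR (- t)) <= 0.
Proof.
have /orP[st|st] := le_total s t.
  by rewrite mulr_le0_ge0 ?subr_le0 // subr_ge0 ler_expR lerN2.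
by rewrite mulr_ge0_le0 ?subr_ge0 // subr_le0 ler_expR lerN2.
Qed.

(** Every summand of E(u, e^{-u}) is nonpositive, and zero only if u agrees on
    the two ends of the edge. *)
Lemma dirichlet_expN_cst u : domQ b m u ->
  0 <= dirichlet b u (fun x => expR (- u x)) -> forall x y, u x = u y.
Proof.
move=> du ge0; set v := fun x => expR (- u x) in ge0.
have suv := edge_prod_summable b u v du.1 (domQ_expN _ du).1.
have neg p : 0 <= - edge_prod b u v p.
  by rewrite oppr_ge0 /edge_prod -mulrA mulr_ge0_le0 ?weight_ge0 // sub_mul_expN_le0.
have zero p : edge_prod b u v p = 0.
  apply/eqP; rewrite -oppr_eq0; apply/eqP.
  apply: (tsum_eq0 (fun p => - edge_prod b u v p)) => //; first exact: abs_summableN.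
  by rewrite tsumN // oppr_le0.
apply: (dirichlet0_cst b) => //; [exact: cc.1|exact: du.1|].
rewrite /dirichlet; suff -> : edge_prod b u u = fun=> 0 by rewrite tsum0.
apply/funext => p; have /eqP := zero p; rewrite /edge_prod !mulf_eq0.
move=> /orP[/orP[]/eqP->|]; rewrite ?mul0r ?mulr0 //.
by rewrite subr_eq0 => /eqP/expR_inj/oppr_inj ->; rewrite subrr mulr0.
Qed.

Lemma solution_necessary u x0 : h x0 != 0 ->
  (forall v, domQ b m v -> 2^-1 * dirichlet b u v = exp_pairing m h u v) ->
  domQ b m u -> tsum (fun x => h x * m x) < 0 /\ changes_sign h.
Proof.
move=> hx0 Hu du; split.
  have dv := domQ_expN _ du; have := Hu _ dv.
  have -> : exp_pairing m h u (fun x => expR (- u x)) = tsum (fun x => h x * m x).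
    congr tsum; apply/funext => x.
    by rewrite -[h x * _ * _]mulrA expRxMexpNx_1 mulr1.
  move=> <-; rewrite pmulr_rlt0 ?invr_gt0 // ltNge; apply/negP => ge0.
  have uc := dirichlet_expN_cst _ du ge0.
  have := Hu _ (domQ_indic b m m_gt0 m_fin x0).
  rewrite exp_pairing_indic (dirichlet_eq b u (fun=> 0) _ (fun x => (x == x0)%:R)) //; last first.
    by move=> x y; rewrite (uc x y) !subrr.
  rewrite /dirichlet; have -> : edge_prod b (fun=> 0) (fun x => (x == x0)%:R) = fun=> 0.
    by apply/funext => p; rewrite /edge_prod subrr mulr0 mul0r.
  rewrite tsum0 mulr0 => /esym/eqP; rewrite !mulf_eq0 (negPf hx0) expR_eq0.
  by rewrite gt_eqF.
have d1 := domQ_cst b m m_gt0 m_fin 1.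
have s1 := exp_pairing_summable b m h m_gt0 m_fin cc h_ell2 _ _ du d1.
have sum0 : exp_pairing m h u (fun=> 1) = 0.
  rewrite -Hu // /dirichlet; have -> : edge_prod b u (fun=> 1) = fun=> 0.
    by apply/funext => p; rewrite /edge_prod subrr mulr0.
  by rewrite tsum0 mulr0.
have em x : 0 < expR (u x) * m x by rewrite mulr_gt0 ?expR_gt0.
have nz : h x0 * expR (u x0) * 1 * m x0 != 0.
  by rewrite mulr1 -mulrA mulf_neq0 // gt_eqF.
split; apply: contrapT => H.
  have hle x : h x <= 0 by rewrite leNgt; apply/negP => hx; apply: H; exists x.
  move/eqP: nz; apply; apply: oppr_inj; rewrite oppr0.
  apply: (tsum_eq0 (fun x => - (h x * expR (u x) * 1 * m x))).
  - by move=> x; rewrite oppr_ge0 mulr1 -mulrA mulr_le0_ge0 // ltW.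
  - exact: abs_summableN.
  - by rewrite tsumN // -/(exp_pairing m h u _) sum0 oppr0.
have hge x : 0 <= h x by rewrite leNgt; apply/negP => hx; apply: H; exists x.
move/eqP: nz; apply; apply: (tsum_eq0 (fun x => h x * expR (u x) * 1 * m x)) => //.
  by move=> x; rewrite mulr1 -mulrA mulr_ge0 // ltW.
by rewrite -/(exp_pairing m h u _) sum0.
Qed.

Lemma solution_exists x0 : 0 < h x0 -> tsum (fun x => h x * m x) < 0 ->
  exists2 u, domL b m u & laplacian b m u = (fun x => h x * expR (u x)).
Proof.
move=> hx0 hneg.
have [u [a [du a0 Hu]]] := euler_lagrange b m h m_gt0 m_fin cc h_ell2 x0 hx0 hneg.
(* Shifting u by c multiplies <h e^u, v> by e^c and leaves the energy alone. *)
pose c := ln (2^-1 * a); pose U x := u x + c.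
have a2 : 0 < 2^-1 * a by rewrite mulr_gt0 // invr_gt0.
have dU : domQ b m U.
  have := domQ_addM b m m_gt0 m_fin cc 1 _ _ du (domQ_cst b m m_gt0 m_fin c).
  by congr (domQ b m _); apply/funext => x; rewrite mul1r.
have rU : represents_Q b m U (fun x => h x * expR (U x)).
  split.
    apply/ell2P => //; have [K HK] := expR_bounded b m cc _ dU.
    have /ell2P sh := h_ell2.
    apply: (le_abs_summable _ _ _ (abs_summableZ (K ^+ 2) _ (sh m_gt0))) => x.
    have m0 : 0 <= m x by exact: ltW.
    rewrite ger0_norm; last by rewrite mulr_ge0 ?sqr_ge0.
    rewrite mulrA ler_wpM2r // exprMn mulrC.
    rewrite ler_wpM2r ?sqr_ge0 // -(real_normK (num_real (expR _))).
    by rewrite lerXn2r ?nnegrE // (le_trans _ (HK x)).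
  move=> v dv; change (2^-1 * dirichlet b U v = exp_pairing m h U v).
  rewrite (exp_pairing_shift b m h m_gt0 m_fin cc h_ell2 c) // lnK //.
  rewrite (dirichlet_eq b _ u _ v) //; last by move=> x y; rewrite /U; ring.
  by rewrite Hu // mulrA.
exists U; last exact: laplacianE.
by split => //; exists (fun x => h x * expR (U x)).
Qed.

End Equation.

Theorem theorem3p1 (R : realType) (X : countType)
    (b : weighted_graph R X) (m : X -> R) (h : X -> R)
    (m_gt0 : forall x, 0 < m x)
    (m_fin : (vol m [set: X] < +oo)%E)
    (cc : canonically_compactifiable b m)
    (h_ell2 : ell2 m h) (h_neq0 : h <> cst 0) :
  (exists2 u : X -> R, domL b m u &
     laplacian b m u = (fun x => h x * expR (u x)))
  <-> (mean m h < 0 /\ changes_sign h).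
Proof.
have [x0 hx0] : exists x0, h x0 != 0.
  apply: contrapT => H; apply: h_neq0; apply/funext => x.
  by apply/eqP/negPn/negP => hx; apply: H; exists x.
rewrite (mean_lt0E m h m_gt0 m_fin x0); split.
  move=> [u dLu Lu].
  apply: (solution_necessary b m h m_gt0 m_fin cc h_ell2 u x0 hx0 _ dLu.1).
  exact: solution_pairing.
by move=> [hneg [[x hx] _]]; apply: (solution_exists b m h) hx hneg.
Qed.
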